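(* Let $\mathcal G=\{g_k\}_{k\in G}$ be a frame for a Hilbert space $\mathbb H$, let $\mathcal F=\{f_i\}_{i\in I}\subseteq\mathbb H$ satisfy $\|f_i\|\ge u>0$ for all $i\in I$, and let $a:I\to G$ be such that $(\mathcal F,a,\mathcal G)$ is $\ell_2$-localized. Then for every $J\subseteq I$, with $\mathcal F_J=\{f_j\}_{j\in J}$, $$D^-(a;J)\le D^-(\mathcal F_J;\mathcal G)\quad\text{and}\quad D^+(a;J)=D^+(\mathcal F_J;\mathcal G).$$ If, moreover, $\mathcal F$ is Bessel, then $D^-(a;J)=D^-(\mathcal F_J;\mathcal G)$.
   Context: $I$ is a countable index set and $G=\mathbb Z^{d_1}\times\mathbb Z_{N_1}\times\cdots\times\mathbb Z_{N_{d_2}}$ with $d_1,d_2\in\mathbb N$, where $\mathbb Z_N=\{0,1,\dots,N-1\}$ is the cyclic group of order $N$. For $k\in G$, $R>0$ put $B_R(k)=\{g\in G:\|g-k\|_\infty=\max_{1\le j\le d_1+d_2}|g(j)-k(j)|\le R\}$. $\mathcal G$ is a frame if there are $0<A\le B<\infty$ with $A\|f\|^2\le\sum_{k}|\langle f,g_k\rangle|^2\le B\|f\|^2$ for all $f\in\mathbb H$; a family $\mathcal F$ is Bessel if $\sum_i|\langle f,f_i\rangle|^2\le B\|f\|^2$ for all $f$ and some $B<\infty$. $(\mathcal F,a,\mathcal G)$ is $\ell_2$-localized if there is $r\in\ell_2(G)$ with $|\langle f_i,g_{k'}\rangle|\le r(a(i)-k')$ for all $i\in I$, $k'\in G$. Index-map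 density (values in $[0,\infty]$): for $J\subseteq I$, $$D^-(a;J)=\liminf_{R\to\infty}\inf_{k\in G}\frac{|a^{-1}(B_R(k))\cap J|}{|B_R(0)|},\qquad D^+(a;J)=\limsup_{R\to\infty}\sup_{k\in G}\frac{|a^{-1}(B_R(k))\cap J|}{|B_R(0)|}.$$ Density with respect to $\mathcal G$ (values in $[0,\infty]$, sums over $f\in\mathcal F$ are over the indexed family, i.e. counted with multiplicity): with $a_f=\big(\sum_{n\in G}|\langle f,g_n\rangle|^2\big)^{-1}$, $$D^-(\mathcal F;\mathcal G)=\liminf_{R\to\infty}\inf_{k\in G}\frac{\sum_{f\in\mathcal F}a_f\sum_{n\in B_R(k)}|\langle f,g_n\rangle|^2}{|B_R(0)|},\quad D^+(\mathcal F;\mathcal G)=\limsup_{R\to\infty}\sup_{k\in G}\frac{\sum_{f\in\mathcal F}a_f\sum_{n\in B_R(k)}|\langle f,g_n\rangle|^2}{|B_R(0)|}.$$ *)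

(* Defs.v *)
From HB Require Import structures.
From mathcomp Require Import all_boot all_order all_algebra.
From mathcomp Require Import complex.
From mathcomp Require Import all_classical all_reals all_analysis.

Set Implicit Arguments.
Unset Strict Implicit.
Unset Printing Implicit Defensive.

Import Order.TTheory GRing.Theory Num.Theory.
Import numFieldNormedType.Exports.

Local Open Scope classical_set_scope.
Local Open Scope ring_scope.

(* Hilbert spaces are over the reals or over the complex numbers. The norm of
   a normed module over [K] is valued in [K], so [magnitude] and [hnorm] bring
   it back to [R], where sums and densities live. *)
Variant scalar_kind := real_scalars | complex_scalars.

Definition scalars (R : realType) (s : scalar_kind) : numFieldType :=
  match s with real_scalars => R | complex_scalars => R[i] end.

Definition scalar_conj (R : realType) (s : scalar_kind) :
    scalars R s -> scalars R s :=
  match s return scalars R s -> scalars R s with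
  | real_scalars => fun z => z
  | complex_scalars => fun z => conjc z
  end.

Definition scalar_re (R : realType) (s : scalar_kind) : scalars R s -> R :=
  match s return scalars R s -> R with
  | real_scalars => fun z => z
  | complex_scalars => fun z => complex.Re z
  end.

Arguments scalar_conj {R s}.
Arguments scalar_re {R s}.

Definition magnitude (R : realType) (s : scalar_kind) (z : scalars R s) : R :=
  scalar_re `|z|.

Definition hnorm (R : realType) (s : scalar_kind)
    (H : normedModType (scalars R s)) (x : H) : R :=
  scalar_re `|x|.

(* A complete normed module [H] is a Hilbert space for the inner product [ip]
   when its norm is the one that [ip] induces. *)
Definition hilbert_for (R : realType) (s : scalar_kind)
    (H : completeNormedModType (scalars R s)) (ip : {dot H for scalar_conj}) :=
  forall x : H, ip x x = `|x| ^+ 2.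

(* Z_{N_1} x ... x Z_{N_d}. The group structure on ordinals is canonical only
   on ['I_n.+1]; for positive [N j], ['I_(N j).-1.+1] is {0, ..., N j - 1} with
   addition modulo [N j], including the case [N j = 1] (unlike ['Z_(N j)]). *)
Definition cyclic_prod (d : nat) (N : 'I_d -> nat) : Type :=
  {dffun forall j : 'I_d, 'I_(N j).-1.+1}.

Section CyclicProd.
Variables (d : nat) (N : 'I_d -> nat).
Local Notation T := (cyclic_prod N).

HB.instance Definition _ := Choice.copy T
  {dffun forall j : 'I_d, ('I_(N j).-1.+1 : choiceType)}.

Definition cyclic_prod_zero : T := [ffun j => 0].
Definition cyclic_prod_opp (x : T) : T := [ffun j => - x j].
Definition cyclic_prod_add (x y : T) : T := [ffun j => x j + y j].

Fact cyclic_prod_addA : associative cyclic_prod_add.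
Proof. by move=> x y z; apply/ffunP => j; rewrite !ffunE addrA. Qed.
Fact cyclic_prod_addC : commutative cyclic_prod_add.
Proof. by move=> x y; apply/ffunP => j; rewrite !ffunE addrC. Qed.
Fact cyclic_prod_add0 : left_id cyclic_prod_zero cyclic_prod_add.
Proof. by move=> x; apply/ffunP => j; rewrite !ffunE add0r. Qed.
Fact cyclic_prod_addN :
  left_inverse cyclic_prod_zero cyclic_prod_opp cyclic_prod_add.
Proof. by move=> x; apply/ffunP => j; rewrite !ffunE addNr. Qed.

HB.instance Definition _ := GRing.isZmodule.Build T
  cyclic_prod_addA cyclic_prod_addC cyclic_prod_add0 cyclic_prod_addN.

End CyclicProd.

Definition index_group (d1 d2 : nat) (N : 'I_d2 -> nat) : zmodType :=
  ({ffun 'I_d1 -> int} * cyclic_prod N)%type.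

Section Density.
Variables (d1 d2 : nat) (N : 'I_d2 -> nat).
Local Notation G := (index_group d1 N).

(* On the cyclic coordinates, |g(j) - k(j)| is the distance between the
   representatives in {0, ..., N_j - 1}, not a distance modulo N_j. *)
Definition supdist (g k : G) : nat :=
  maxn (\max_(j < d1) `|g.1 j - k.1 j|%N)
       (\max_(j < d2) `|(g.2 j : nat)%:Z - (k.2 j : nat)%:Z|%N).

Definition cube (R : realType) (r : R) (k : G) : set G :=
  [set g | (supdist g k)%:R <= r].

Local Open Scope ereal_scope.

Definition index_ratio (R : realType) (I : countType) (a : I -> G) (J : set I)
    (r : R) (k : G) : \bar R :=
  counting (a @^-1` cube r k `&` J) / counting (cube r 0%R).

Definition lower_index_density (R : realType) (I : countType) (a : I -> G)
    (J : set I) : \bar R :=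
  limf_einf (fun r : R => ereal_inf (range (index_ratio a J r)))
    (pinfty_nbhs R).

Definition upper_index_density (R : realType) (I : countType) (a : I -> G)
    (J : set I) : \bar R :=
  limf_esup (fun r : R => ereal_sup (range (index_ratio a J r)))
    (pinfty_nbhs R).

Section Hilbert.
Variables (R : realType) (s : scalar_kind).
Variables (H : completeNormedModType (scalars R s)).
Variables (ip : {dot H for scalar_conj}).

Definition coef_mass (g : G -> H) (A : set G) (x : H) : \bar R :=
  \esum_(n in A) (magnitude (ip x (g n)) ^+ 2)%:E.

Definition frame (g : G -> H) : Prop :=
  exists A B : R, [/\ (0 < A)%R, (A <= B)%R & forall x : H,
    (A * hnorm x ^+ 2)%:E <= coef_mass g [set: G] x <= (B * hnorm x ^+ 2)%:E].

Definition bessel (I : countType) (f : I -> H) : Prop :=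
  exists B : R, forall x : H,
    \esum_(i in [set: I]) (magnitude (ip x (f i)) ^+ 2)%:E
      <= (B * hnorm x ^+ 2)%:E.

(* A real-valued [r] is no restriction: it bounds nonnegative reals. *)
Definition l2_localized (I : countType) (f : I -> H) (a : I -> G) (g : G -> H)
    : Prop :=
  exists r : G -> R,
    \esum_(k in [set: G]) (`|r k| ^+ 2)%:E < +oo
    /\ forall (i : I) (k : G), (magnitude (ip (f i) (g k)) <= r (a i - k))%R.

(* The density of the subfamily {f_j}_{j in J} uses this ratio; (coef_mass g
   setT (f j))^-1 is the normalization a_f. *)
Definition frame_ratio (I : countType) (f : I -> H) (J : set I) (g : G -> H)
    (r : R) (k : G) : \bar R :=
  (\esum_(j in J) ((coef_mass g [set: G] (f j))^-1
                   * coef_mass g (cube r k) (f j)))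
  / counting (cube r 0%R).

Definition lower_frame_density (I : countType) (f : I -> H) (J : set I)
    (g : G -> H) : \bar R :=
  limf_einf (fun r : R => ereal_inf (range (frame_ratio f J g r)))
    (pinfty_nbhs R).

Definition upper_frame_density (I : countType) (f : I -> H) (J : set I)
    (g : G -> H) : \bar R :=
  limf_esup (fun r : R => ereal_sup (range (frame_ratio f J g r)))
    (pinfty_nbhs R).

End Hilbert.
End Density.

Arguments lower_index_density {d1 d2 N} R {I} a J.
Arguments upper_index_density {d1 d2 N} R {I} a J.

(* Main.v *)
Require Import Defs.
From HB Require Import structures.
From mathcomp Require Import all_boot all_order all_algebra.
From mathcomp Require Import finmap complex.
From mathcomp Require Import lra zify.
From mathcomp Require Import all_classical all_reals all_analysis.

Set Implicit Arguments.
Unset Strict Implicit.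
Unset Printing Implicit Defensive.

Import Order.TTheory GRing.Theory Num.Theory.
Import numFieldNormedType.Exports.

Local Open Scope classical_set_scope.
Local Open Scope ring_scope.

(** The normalized coefficients
      m_i(n) = |<f_i, g_n>|^2 / sum_n' |<f_i, g_n'>|^2
    form a probability distribution on G for each i. The lower frame bound
    and |f_i| >= u bound the denominators away from 0, so localization turns
    into m_i(n) <= rho(a(i) - n) for one summable rho: the unit mass of f_i sits
    around a(i), and the mass farther than S from a(i) is at most the tail of
    rho, uniformly in i. The numerators to be compared over a cube B_r(k) are
    the number of j in J with a(j) in B_r(k), and the total mass
    sum_(j in J) m_j(B_r(k)).

    If a(j) lies in B_r(k), nearly all the mass of j lies in B_(r+S)(k). So the
    count over B_r(k) is at most (1 + e) times the mass of B_(r+S)(k)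
    (cube_count_le_mass), and both index densities are at most the
    corresponding frame densities.

    Conversely the mass of B_r(k) is at most the count over B_(r+S)(k) plus the
    contributions of the j with a(j) outside B_(r+S)(k). Each n in B_r(k)
    receives from those at most the tail of rho times the largest size C of a
    fibre J /\ a^-1(x), so an error of at most e |B_r| remains
    (cube_mass_le_count) as soon as the fibres are uniformly bounded. They are
    when the upper index density is finite, since x lies in B_r(x); when it is
    infinite, the equality of upper densities follows from the first half. They
    are also bounded when F is Bessel: every j in the fibre over x puts half of
    its mass on a fixed ball around x, while the frame vectors are bounded, so
    that F being Bessel bounds the total mass sum_j m_j(n) received by each n
    (fibre_bound_of_columns).

    Replacing r by r + S is harmless: |B_(r+S)| / |B_r| tends to 1
    (cube_volume_growth), and lower and upper limits ignore the shift
    (limf_inf_sup_le). *)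

(** * Sums of nonnegative families *)

Section Esum.
Context {R : realType}.
Local Open Scope ereal_scope.

Lemma esum_subset (T : choiceType) (A B : set T) (w : T -> \bar R) :
  A `<=` B -> (forall x, 0 <= w x) -> \esum_(x in A) w x <= \esum_(x in B) w x.
Proof.
move=> AB w0; rewrite [leRHS](esumID A)//.
by rewrite (setIidr AB) leeDl// esum_ge0.
Qed.

Lemma esum_scale (T : choiceType) (A : set T) (c : R) (w : T -> \bar R) :
  (0 < c)%R -> (forall x, 0 <= w x) ->
  \esum_(x in A) (c%:E * w x) = c%:E * \esum_(x in A) w x.
Proof.
move=> c0 w0; rewrite /esum -ereal_sup_pZl//; congr ereal_sup.
apply/seteqP; split=> [_ [X AX <-]|_ [_ [X AX <-] <-]]/=.
  by exists (\sum_(x \in X) w x); [exists X|rewrite ge0_mule_fsumr].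
by exists X => //; rewrite ge0_mule_fsumr.
Qed.

Lemma esum_exchange (T1 T2 : choiceType) (A : set T1) (B : set T2)
    (w : T1 -> T2 -> \bar R) : (forall x y, 0 <= w x y) ->
  \esum_(x in A) \esum_(y in B) w x y = \esum_(y in B) \esum_(x in A) w x y.
Proof.
move=> w0; rewrite !esum_esum//.
rewrite (@reindex_esum _ _ _ (B `*`` (fun=> A)) _ (fun z => (z.2, z.1)))//.
split; first by move=> [y x] [].
  by move=> [y x] [y' x'] _ _ /= [-> ->].
by move=> [x y] [Ax By]; exists (y, x).
Qed.

Lemma counting_esum (T : choiceType) (A : set T) :
  counting A = \esum_(x in A) (1 : \bar R).
Proof.
have finE (X : set T) : finite_set X ->
    \esum_(x in X) (1 : \bar R) = (#|` fset_set X |)%:R%:E.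
  move=> finX; rewrite esum_fset// fsbig_finite//= big_const_seq count_predT.
  by elim: (size _) => [|n ih] //=; rewrite ih -EFinD nat1r.
rewrite /counting; case: asboolP => [/finE //|infA].
apply/esym/eqyP => r r0.
have [X XA Xr] := infinite_set_fset (Num.truncn r).+1 infA.
apply: le_trans (esum_subset XA _) => //.
rewrite finE// set_fsetK lee_fin; apply/ltW/(lt_le_trans (truncnS_gt r)).
by rewrite ler_nat.
Qed.

Lemma esum_const (T : choiceType) (A : set T) (c : R) : (0 <= c)%R ->
  \esum_(x in A) c%:E = c%:E * counting A.
Proof.
rewrite le_eqVlt => /predU1P[<-|c0]; first by rewrite mul0e esum1.
rewrite counting_esum -esum_scale//.
by apply: eq_esum => x _; rewrite mule1.
Qed.

Lemma counting_ge0 (T : choiceType) (A : set T) : 0 <= counting A :> \bar R.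
Proof. by rewrite counting_esum esum_ge0. Qed.

(** The fibre over [y] is the part of [A] that [b] sends to [y]; the sum is
    regrouped by reindexing [A] along its graph [x |-> (b x, x)]. *)
Lemma esum_fibres (T1 T2 : choiceType) (A : set T1) (B : set T2)
    (b : T1 -> T2) (w : T1 -> \bar R) :
  (forall x, 0 <= w x) -> (forall x, A x -> B (b x)) ->
  \esum_(x in A) w x = \esum_(y in B) \esum_(x in A `&` b @^-1` [set y]) w x.
Proof.
move=> w0 AB; rewrite esum_esum//.
rewrite (@reindex_esum _ _ _ A _ (fun x => (b x, x)))//; split.
- by move=> x Ax; split=> //=; exact: AB.
- by move=> x y _ _ [].
- by move=> [y x] /= [_ [Ax <-]]; exists x.
Qed.

(** A finite set carries the sum up to [e]; [S] is the largest value of [p] on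
    it. *)
Lemma esum_tail (T : choiceType) (w : T -> \bar R) (p : T -> nat) (e : R) :
  (forall x, 0 <= w x) -> \esum_(x in [set: T]) w x < +oo -> (0 < e)%R ->
  exists S : nat, \esum_(x in [set x | (S < p x)%N]) w x <= e%:E.
Proof.
move=> w0 woo e0.
have wfin : \esum_(x in [set: T]) w x \is a fin_num.
  by rewrite ge0_fin_numE// esum_ge0.
have [_ [X [finX _] <-]] := ub_ereal_sup_adherent e0 wfin.
rewrite -/(esum _ _) -esum_fset// => Xe.
have [S XS] : exists S, forall x, X x -> (p x <= S)%N.
  exists (\max_(x <- fset_set X) p x)%N => x Xx.
  by apply: (@leq_bigmax_seq _ _ xpredT p) => //; rewrite in_fset_set// inE.
exists S.
have Xfin : \esum_(x in X) w x \is a fin_num.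
  rewrite ge0_fin_numE ?esum_ge0//; apply: le_lt_trans woo.
  exact: esum_subset.
have : \esum_(x in X) w x + \esum_(x in [set x | (S < p x)%N]) w x
    <= \esum_(x in [set: T]) w x.
  rewrite [leRHS](esumID X)// !setTI leeD2l//; apply: esum_subset => // x /= Sx.
  by move=> /XS; rewrite leqNgt Sx.
move=> h; move: Xe; rewrite lteBlDr// => Xe.
have := le_trans h (ltW Xe).
by rewrite leeD2lE.
Qed.

End Esum.

(** * Lower and upper limits under a shift and a small perturbation *)

Section AsymptoticComparison.
Context {R : realType}.
Local Open Scope ereal_scope.

Lemma le_of_perturbed (x y : \bar R) : 0 <= y ->
  (forall e : R, (0 < e)%R -> x <= (1 + e)%:E * y + e%:E) -> x <= y.
Proof.
case: y => [y| |] y0 xy; [|by rewrite leey|by []].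
rewrite lee_fin in y0; apply/lee_addgt0Pr => e e0.
have y1 : (0 < 1 + y)%R by rewrite ltr_pwDl.
have := xy (e / (1 + y))%R (divr_gt0 e0 y1).
rewrite -EFinM -!EFinD; congr (_ <= _%:E).
rewrite -[X in _ = (y + X)%R](divfK (lt0r_neq0 y1)) mulrDr mulr1.
by rewrite mulrDl mul1r -addrA [X in (y + X)%R]addrC.
Qed.

(** Every neighbourhood of infinity contains a half-line, and half-lines are
    stable under translation by [S] up to moving their endpoint; this is why
    [S] may depend on [e]. Nonnegativity of [F'] makes the limit nonnegative,
    which letting [e] tend to 0 requires. *)
Lemma limf_inf_sup_le (G : Type) (k0 : G) (F F' : R -> G -> \bar R) :
  (forall r k, 0 <= F' r k) ->
  (forall e : R, (0 < e)%R -> exists S : nat, \forall r \near +oo%R,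
     forall k, F r k <= (1 + e)%:E * F' (r + S%:R)%R k + e%:E) ->
  limf_einf (fun r => ereal_inf (range (F r))) (pinfty_nbhs R)
    <= limf_einf (fun r => ereal_inf (range (F' r))) (pinfty_nbhs R)
  /\ limf_esup (fun r => ereal_sup (range (F r))) (pinfty_nbhs R)
    <= limf_esup (fun r => ereal_sup (range (F' r))) (pinfty_nbhs R).
Proof.
move=> F'0 FF'; split.
  rewrite [X in X <= _]limf_einfE; apply/ereal_supP => _ [V [M0 [_ VM0]] <-].
  apply: le_of_perturbed => [|e e0].
    rewrite limf_einfE; apply: ereal_sup_ge.
    exists (ereal_inf [set ereal_inf (range (F' r)) | r in [set: R]]).
      by exists [set: R] => //; exact: filterT.
    apply/ereal_infP => _ [r _ <-]; apply/ereal_infP => _ [k _ <-].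
    exact: F'0.
  have [S [M [_ MS]]] := FF' e e0.
  have e1 : (0 < 1 + e)%R by rewrite ltr_pwDl// ltW.
  rewrite -leeBlDr// -lee_pdivrMl// limf_einfE; apply: ereal_sup_ge.
  set V' := [set r : R | (Num.max M0 M + S%:R < r)%R].
  exists (ereal_inf [set ereal_inf (range (F' r)) | r in V']).
    by exists V' => //; exists (Num.max M0 M + S%:R)%R; split=> //; exact: num_real.
  apply/ereal_infP => _ [r + <-]; rewrite /V'/= -ltrBrDr gt_max => /andP[M0r Mr].
  apply/ereal_infP => _ [k _ <-]; rewrite lee_pdivrMl// EFinN leeBlDr//.
  have := MS _ Mr k; rewrite subrK; apply: le_trans.
  apply: le_trans (ereal_inf_lbound _) _; first by exists (r - S%:R)%R; [exact: VM0|].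
  by apply: ereal_inf_lbound; exists k.
apply: le_of_perturbed => [|e e0].
  apply: limf_esup_ge0 => [|r]; first exact: filter_not_empty.
  by apply: ereal_sup_ge; exists (F' r k0) => //; exists k0.
have [S [M [_ MS]]] := FF' e e0.
have e1 : (0 < 1 + e)%R by rewrite ltr_pwDl// ltW.
rewrite -leeBlDr// -lee_pdivrMl// [leRHS]limf_esupE.
apply/ereal_infP => _ [V' [M0 [_ V'M0]] <-].
rewrite lee_pdivrMl// leeBlDr//.
set V := [set r : R | (Num.max M0 M < r)%R].
apply: le_trans (ereal_inf_lbound _) _.
  by exists V => //; exists (Num.max M0 M)%R; split=> //; exact: num_real.
apply/ereal_supP => _ [r + <-]; rewrite /V/= gt_max => /andP[M0r Mr].
apply/ereal_supP => _ [k _ <-].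
apply: le_trans (MS _ Mr k) _; rewrite leeD2r// lee_pmul2l// ?lte_fin//.
apply: le_trans (_ : ereal_sup (range (F' (r + S%:R)%R)) <= _).
  by apply: ereal_sup_ubound; exists k.
apply: ereal_sup_ubound; exists (r + S%:R)%R => //; apply: V'M0.
by rewrite (lt_le_trans M0r)// lerDl.
Qed.

End AsymptoticComparison.

(** * Cubes in the index group *)

Lemma counting_fintype (R : realType) (T : finType) :
  counting [set: T] = #|T|%:R%:E :> \bar R.
Proof.
have -> : [set: T] = [set` enum T].
  by apply/seteqP; split=> // x _; rewrite /= mem_enum.
rewrite counting_esum esum_fset// -fsbig_seq ?enum_uniq//.
rewrite big_const_seq count_predT -cardE.
by elim: #|T| => [|n ih] //=; rewrite ih -EFinD nat1r.
Qed.

Section Cubes.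
Variables (d1 d2 : nat) (N : 'I_d2 -> nat).
Local Notation G := (index_group d1 N).

(** The cyclic coordinates are bounded, so they do not matter for large cubes.
    Forgetting them turns [supdist], which is not translation invariant on the
    cyclic part, into a translation-invariant pseudometric. *)
Definition free_norm (x : G) : nat := \max_(j < d1) `|x.1 j|%N.

Lemma supdistkk (k : G) : supdist k k = 0%N.
Proof.
apply/eqP; rewrite -leqn0 geq_max; apply/andP; split;
  by apply/bigmax_leqP => j _; rewrite subrr.
Qed.

Lemma free_coordB (x y : G) j : (x - y).1 j = x.1 j - y.1 j.
Proof. by rewrite !ffunE. Qed.

Lemma free_normN (x : G) : free_norm (- x) = free_norm x.
Proof. by apply: eq_bigr => j _; rewrite ffunE abszN. Qed.

Lemma free_normD (x y : G) :
  (free_norm (x + y) <= free_norm x + free_norm y)%N.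
Proof.
apply/bigmax_leqP => j _; rewrite ffunE.
have hx : (`|x.1 j| <= free_norm x)%N by apply: (leq_bigmax j).
have hy : (`|y.1 j| <= free_norm y)%N by apply: (leq_bigmax j).
apply: leq_trans (leq_add hx hy).
by move: (x.1 j) (y.1 j) => a b; lia.
Qed.

Context {R : realType}.

Definition cyclic_bound : R := (\max_(j < d2) N j)%:R.

(** Past [cyclic_bound] the condition on the cyclic coordinates always holds:
    representatives lie in {0, ..., (N j).-1}. *)
Lemma cubeE (r : R) (k : G) : cyclic_bound <= r ->
  cube r k = [set g | (free_norm (g - k))%:R <= r].
Proof.
move=> Nr; apply/seteqP; split=> g; rewrite /cube/= => gk.
  apply: le_trans gk; rewrite ler_nat; apply: leq_trans (leq_maxl _ _).
  by apply/eq_leq/eq_bigr => j _; rewrite free_coordB.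
rewrite natr_max ge_max; apply/andP; split.
  apply: le_trans gk; rewrite ler_nat.
  by apply/eq_leq/eq_bigr => j _; rewrite free_coordB.
apply: le_trans Nr; rewrite ler_nat; apply/bigmax_leqP => j _.
apply: leq_trans (leq_bigmax j).
have := ltn_ord (g.2 j); have := ltn_ord (k.2 j); lia.
Qed.

Definition cube_volume (r : R) : R :=
  ((Num.truncn r).*2.+1 ^ d1
   * #|{dffun forall j : 'I_d2, 'I_(N j).-1.+1}|)%:R.

Lemma cube_volume_gt0 r : 0 < cube_volume r.
Proof.
rewrite ltr0n muln_gt0 expn_gt0/=; apply/card_gt0P.
by exists (0 : cyclic_prod N).
Qed.

(** In each of the [d1] free directions the cube is the integer interval of
    radius [Num.truncn r] around [k]; the cyclic part is everything. *)
Lemma counting_cube (r : R) (k : G) : cyclic_bound <= r ->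
  counting (cube r k) = (cube_volume r)%:E.
Proof.
move=> Nr; have r0 : 0 <= r by apply: le_trans Nr; exact: ler0n.
rewrite cubeE//; set n := Num.truncn r.
pose T : finType := ({ffun 'I_d1 -> 'I_n.*2.+1}
  * {dffun forall j : 'I_d2, 'I_(N j).-1.+1})%type.
have -> : cube_volume r = #|T|%:R.
  by rewrite /cube_volume card_prod card_ffun !card_ord.
rewrite -counting_fintype !counting_esum.
pose e (z : T) : G := ([ffun j => k.1 j + ((z.1 j)%:Z - n%:Z)], z.2).
apply: (@reindex_esum _ _ _ setT _ e); split.
- move=> [x c] _ /=; rewrite -truncn_ge_nat//; apply/bigmax_leqP => j _.
  rewrite free_coordB/= ffunE; have := ltn_ord (x j).
  by rewrite addrAC subrr add0r -/n; clearbody n; move: (x j : nat) => m; lia.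
- move=> [x c] [y c'] _ _ [xy ->]; congr (_, _); apply/ffunP => j.
  move/ffunP/(_ j): xy; rewrite !ffunE => /addrI/addIr xy.
  by apply/val_inj; case: xy.
- move=> g /=; rewrite -truncn_ge_nat// -/n => gk.
  have gj j : (`|g.1 j - k.1 j| <= n)%N.
    by apply: leq_trans gk; rewrite -free_coordB; apply: (leq_bigmax j).
  exists ([ffun j => inord `|(g.1 j - k.1 j + n%:Z)%R|%N], g.2) => //.
  rewrite /e [RHS]surjective_pairing; congr (_, _); apply/ffunP => j /=.
  rewrite !ffunE; have := gj j; move: (k.1 j) (g.1 j) => a b ab.
  by rewrite inordK; lia.
Qed.

(** Pick [q > 1] with [q ^+ d1 < 1 + e]: enlarging the radius by the constant
    [S] multiplies the side length by less than [q] once [r] is large. *)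
Lemma cube_volume_growth (S : nat) (e : R) : 0 < e ->
  \forall r \near +oo, cube_volume (r + S%:R) <= (1 + e) * cube_volume r.
Proof.
move=> e0.
have [q q1 qe] : exists2 q : R, 1 < q & q ^+ d1 < 1 + e.
  near (1 : R)^'+ => q; exists q; first by near: q; exact: nbhs_right_gt.
  near: q; apply: (@cvgr_lt _ _ _ _ (fun x => x ^+ d1) (1 : R)).
    by apply: cvg_at_right_filter; rewrite -[X in _ --> X](expr1n _ d1);
      exact: exprn_continuous.
  by rewrite ltrDl.
near=> r; have r1 : 1 <= r by near: r; exact: nbhs_pinfty_ge.
have rS : S.*2%:R / (q - 1) <= r.
  by near: r; apply: nbhs_pinfty_ge; exact: num_real.
have r0 : 0 <= r by apply: le_trans r1.
rewrite /cube_volume addrC truncnD ?nnegrE ?natr_nat// natrK.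
set n := Num.truncn r; rewrite !natrM mulrA ler_wpM2r// !natrX.
have qn : (S + n).*2.+1%:R <= q * n.*2.+1%:R.
  have rn : r <= n.*2.+1%:R.
    apply: le_trans (ltW (truncnS_gt r)) _; rewrite ler_nat -/n; lia.
  have -> : ((S + n).*2.+1 = S.*2 + n.*2.+1)%N by lia.
  rewrite natrD -lerBrDr -[X in _ - X]mul1r -mulrBl mulrC.
  rewrite ler_pdivrMr ?subr_gt0// in rS; apply: le_trans rS _.
  by rewrite ler_wpM2r// subr_ge0 ltW.
apply: le_trans (_ : (q * n.*2.+1%:R) ^+ d1 <= _).
  by apply: lerXn2r; rewrite ?nnegrE// mulr_ge0// ltW// (lt_trans _ q1).
by rewrite exprMn ler_wpM2r// ?exprn_ge0// ltW.
Unshelve. all: by end_near.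
Qed.

End Cubes.

(** * Localized masses: counting points against adding masses *)

Section LocalizedMasses.
Variables (R : realType) (d1 d2 : nat) (N : 'I_d2 -> nat).
Local Notation G := (index_group d1 N).
Local Notation bound := (@cyclic_bound d2 N R).
Local Notation vol := (@cube_volume d1 d2 N R).
Variables (I : countType) (a : I -> G) (J : set I).
Variables (m : I -> G -> \bar R) (rho : G -> R).
Local Open Scope ereal_scope.
Hypothesis m_ge0 : forall i n, 0 <= m i n.
Hypothesis m_sum : forall i, \esum_(n in [set: G]) m i n = 1.
Hypothesis m_le : forall i n, m i n <= (rho (a i - n)%R)%:E.
Hypothesis rho_ge0 : forall x, (0 <= rho x)%R.
Hypothesis rho_sum : \esum_(x in [set: G]) (rho x)%:E < +oo.

Definition cube_mass (r : R) (k : G) : \bar R :=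
  \esum_(j in J) \esum_(n in cube r k) m j n.

Definition cube_count (r : R) (k : G) : \bar R :=
  counting (a @^-1` cube r k `&` J).

Lemma cube_mass_ge0 r k : 0 <= cube_mass r k.
Proof. by apply: esum_ge0 => j _; apply: esum_ge0. Qed.

(** The reflection [n |-> a i - n] carries the mass far from [a i] under the
    tail of [rho]. *)
Lemma mass_near (e : R) (S : nat) i :
  \esum_(x in [set x : G | (S < free_norm x)%N]) (rho x)%:E <= e%:E ->
  (1 - e)%:E <= \esum_(n in [set n | (free_norm (a i - n)%R <= S)%N]) m i n.
Proof.
move=> Se; rewrite EFinB leeBlDr//.
rewrite -[leLHS](m_sum i).
rewrite [leLHS](esumID [set n | (free_norm (a i - n)%R <= S)%N])//.
rewrite !setTI leeD2l//; apply: le_trans Se.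
apply: (@le_trans _ _ (\esum_(n in
    ~` [set n | (free_norm (a i - n)%R <= S)%N]) (rho (a i - n)%R)%:E)).
  exact: le_esum.
rewrite [leRHS](@reindex_esum _ _ _
  (~` [set n | (free_norm (a i - n)%R <= S)%N]) _ (fun n => a i - n)%R)//.
split.
- by move=> n /= /negP; rewrite -ltnNge.
- by move=> n n' _ _ /addrI/oppr_inj.
- move=> x /= Sx; exists (a i - x)%R; rewrite ?subKr//=.
  by apply/negP; rewrite -ltnNge.
Qed.

(** Each counted [j] brings mass at least [1 - e / (1 + e)], that is
    [(1 + e)^-1], to the cube enlarged by [S]. *)
Lemma cube_count_le_mass (e : R) : (0 < e)%R ->
  exists S : nat, forall r k, (bound <= r)%R ->
    cube_count r k <= (1 + e)%:E * cube_mass (r + S%:R)%R k.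
Proof.
move=> e0; have e1 : (0 < 1 + e)%R by rewrite ltr_pwDl// ltW.
have rho0 (x : G) : 0 <= (rho x)%:E by rewrite lee_fin.
have [S hS] := esum_tail (@free_norm d1 d2 N) rho0 rho_sum (divr_gt0 e0 e1).
exists S => r k Nr; rewrite -lee_pdivrMl// /cube_count.
rewrite -esum_const; last by rewrite invr_ge0 ltW.
apply: (@le_trans _ _ (\esum_(j in a @^-1` cube r k `&` J)
    \esum_(n in cube (r + S%:R)%R k) m j n)); last first.
  apply: esum_subset => [j []//|j]; exact: esum_ge0.
apply: le_esum => j [+ _]; rewrite /preimage/= cubeE//= => jk.
have -> : ((1 + e)^-1 = 1 - e / (1 + e))%R.
  by rewrite -[X in (X - _)%R](divff (lt0r_neq0 e1)) -mulrBl addrK mul1r.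
apply: le_trans (mass_near j hS) _; apply: esum_subset => // n /= nS.
rewrite cubeE/=; last by rewrite (le_trans Nr)// lerDl.
rewrite -(subrKA (a j)) (le_trans (_ : _ <=
    (free_norm (n - a j)%R + free_norm (a j - k)%R)%:R)%R)//.
  by rewrite ler_nat free_normD.
by rewrite natrD addrC lerD// ler_nat -opprB free_normN.
Qed.

(** A point counted in the enlarged cube has mass at most 1. The others are at
    distance more than [S] from every [n] in the cube, so [n] receives from
    them at most the tail of [rho], each term being repeated at most [C]
    times. *)
Lemma cube_mass_le_count (C e : R) : (0 < C)%R -> (0 < e)%R ->
  (forall k, counting (J `&` a @^-1` [set k]) <= C%:E) ->
  exists S : nat, forall r k, (bound <= r)%R ->
    cube_mass r k <= cube_count (r + S%:R)%R k + e%:E * (vol r)%:E.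
Proof.
move=> C0 e0 JC.
have rho0 (x : G) : 0 <= (rho x)%:E by rewrite lee_fin.
have [S hS] := esum_tail (@free_norm d1 d2 N) rho0 rho_sum (divr_gt0 e0 C0).
exists S => r k Nr; have NrS : (bound <= r + S%:R)%R.
  by rewrite (le_trans Nr)// lerDl.
rewrite /cube_mass (esumID (a @^-1` cube (r + S%:R)%R k)); last first.
  by move=> j _; exact: esum_ge0.
apply: leeD.
  rewrite setIC /cube_count counting_esum; apply: le_esum => j _.
  by rewrite -(m_sum j); apply: esum_subset.
rewrite esum_exchange// -(counting_cube k Nr) -esum_const; last exact: ltW.
apply: le_esum => n; rewrite cubeE//= => nk.
set D := J `&` [set j | (S < free_norm (a j - n)%R)%N].
apply: (@le_trans _ _ (\esum_(j in D) (rho (a j - n)%R)%:E)).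
  apply: le_trans (_ : \esum_(j in D) m j n <= _); last exact: le_esum.
  apply: esum_subset => // j [Jj]; rewrite /preimage/= cubeE//= => /negP.
  rewrite -ltNge => jk; split=> //=.
  rewrite -(ltr_nat R) -(ltrD2l r) (lt_le_trans jk)//.
  rewrite -[(a j - k)%R](subrKA n) (le_trans (_ : _ <=
      (free_norm (a j - n)%R + free_norm (n - k)%R)%:R)%R)//.
    by rewrite ler_nat free_normD.
  by rewrite natrD addrC lerD2r.
(* Group the far indices by their displacement [x = a j - n]: those with a
   given [x] lie in the fibre of [a] over [x + n]. *)
rewrite (@esum_fibres _ _ _ _ [set x | (S < free_norm x)%N]
  (fun j => a j - n)%R)//; last by move=> j [].
have -> : e%:E = C%:E * (e / C)%:E by rewrite -EFinM mulrC divfK ?gt_eqF.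
apply: (@le_trans _ _
    (C%:E * \esum_(x in [set x : G | (S < free_norm x)%N]) (rho x)%:E)); last first.
  by rewrite lee_pmul2l.
rewrite -esum_scale//; apply: le_esum => x _.
rewrite (@eq_esum _ _ _ _ (fun=> (rho x)%:E)); last first.
  by move=> j [_ /= ->].
rewrite esum_const// muleC lee_wpmul2r//; apply: le_trans (JC (x + n)%R).
rewrite !counting_esum; apply: esum_subset => // j [[Jj _] /= <-].
by split=> //=; rewrite subrK.
Qed.

End LocalizedMasses.

(** * From cube-wise bounds to densities, and bounds on fibres *)

Section Ratios.
Variables (R : realType) (d1 d2 : nat) (N : 'I_d2 -> nat).
Local Notation G := (index_group d1 N).
Local Notation bound := (@cyclic_bound d2 N R).
Local Notation vol := (@cube_volume d1 d2 N R).
Local Open Scope ereal_scope.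

Lemma div_counting_cube (x : \bar R) (r : R) : (bound <= r)%R ->
  x / counting (cube r (0%R : G)) = x * (vol r)^-1%:E.
Proof. by move=> Nr; rewrite counting_cube// inver gt_eqF// cube_volume_gt0. Qed.

(** Trading the volume of the cube of radius [r] for that of radius [r + S]
    costs a second factor close to 1. *)
Lemma cube_density_le (X Y : R -> G -> \bar R) :
  (forall r k, 0 <= Y r k) ->
  (forall e : R, (0 < e)%R -> exists S : nat, forall r k, (bound <= r)%R ->
     X r k <= (1 + e)%:E * Y (r + S%:R)%R k + e%:E * (vol r)%:E) ->
  let ratio (Z : R -> G -> \bar R) r k := Z r k / counting (cube r (0%R : G)) in
  limf_einf (fun r => ereal_inf (range (ratio X r))) (pinfty_nbhs R)
    <= limf_einf (fun r => ereal_inf (range (ratio Y r))) (pinfty_nbhs R)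
  /\ limf_esup (fun r => ereal_sup (range (ratio X r))) (pinfty_nbhs R)
    <= limf_esup (fun r => ereal_sup (range (ratio Y r))) (pinfty_nbhs R).
Proof.
move=> Y0 XY ratio; apply: (limf_inf_sup_le (0%R : G)) => [r k|e e0].
  by rewrite mule_ge0// inve_ge0 counting_ge0.
(* [t] satisfies [(1 + t) ^+ 2 <= 1 + 3 * t <= 1 + e]. *)
set t := Num.min 1%R (e / 3%:R)%R.
have t0 : (0 < t)%R by rewrite lt_min ltr01/= divr_gt0.
have t1 : (t <= 1)%R by rewrite ge_min lexx.
have te : (3%:R * t <= e)%R by rewrite mulrC -ler_pdivlMr// ge_min lexx orbT.
have [S XYS] := XY t t0; exists S; near=> r => k.
have Nr : (bound <= r)%R by near: r; apply: nbhs_pinfty_ge; exact: num_real.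
have NrS : (bound <= r + S%:R)%R by rewrite (le_trans Nr)// lerDl.
have VS : (vol (r + S%:R) <= (1 + t) * vol r)%R.
  by near: r; exact: cube_volume_growth.
have V0 : (0 < vol r)%R by exact: cube_volume_gt0.
have VS0 : (0 < vol (r + S%:R))%R by exact: cube_volume_gt0.
have tt0 : (0 <= 1 + t)%R by rewrite addr_ge0// ltW.
rewrite /ratio !div_counting_cube//.
have := XYS r k Nr.
have Vi0 : 0 <= (vol r)^-1%:E by rewrite lee_fin invr_ge0 ltW.
move=> /(lee_wpmul2r Vi0)/le_trans; apply.
rewrite ge0_muleDl ?mule_ge0 ?lee_fin ?(ltW t0) ?(ltW V0)//.
rewrite -[X in _ + X]EFinM -muleA mulfK ?gt_eqF//.
apply: leeD; last first.
  by rewrite lee_fin (le_trans _ te)// ler_peMl ?ler1n// ltW.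
apply: (@le_trans _ _ ((1 + t)%:E * ((1 + t)%:E *
    (Y (r + S%:R)%R k * (vol (r + S%:R))^-1%:E)))).
  rewrite lee_wpmul2l// ?lee_fin// muleCA lee_wpmul2l// -EFinM lee_fin.
  by rewrite ler_pdivlMr// ler_pdivrMl// mulrC.
rewrite muleA lee_wpmul2r//.
  by rewrite mule_ge0// lee_fin invr_ge0 ltW.
rewrite -EFinM lee_fin; nra.
Unshelve. all: by end_near.
Qed.

Section FibreBounds.
Variables (I : countType) (a : I -> G) (J : set I).

(** Some single radius [r] already has counts bounded uniformly in [k], and the
    cube of radius [r] around [k] contains [k]. *)
Lemma fibre_bound_of_density : upper_index_density R a J < +oo ->
  exists2 C : R, (0 < C)%R & forall k, counting (J `&` a @^-1` [set k]) <= C%:E.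
Proof.
rewrite /upper_index_density limf_esupE => Doo.
have [V [M [_ MV]] Voo] : exists2 V : set R, pinfty_nbhs R V &
    ereal_sup [set ereal_sup (range (index_ratio a J r)) | r in V] < +oo.
  apply: contrapT => noV; move: Doo; rewrite ltNge => /negP; apply.
  apply/ereal_infP => _ [V FV <-]; rewrite leNgt; apply/negP => Voo.
  by apply: noV; exists V.
set r := (Num.max M bound + 1)%R.
have Mr : (M < r)%R by rewrite ltr_pwDr// le_max lexx.
have Nr : (bound <= r)%R by rewrite ler_wpDr// le_max lexx orbT.
set s := ereal_sup _ in Voo.
have ratio_le k : index_ratio a J r k <= s.
  apply: (@le_trans _ _ (ereal_sup (range (index_ratio a J r)))).
    by apply: ereal_sup_ubound; exists k.
  by apply: ereal_sup_ubound; exists r => //; exact: MV.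
have s0 : 0 <= s.
  apply: le_trans (ratio_le 0%R).
  by rewrite mule_ge0 ?inve_ge0 ?counting_ge0.
have V0 : (0 < vol r)%R by exact: cube_volume_gt0.
exists (fine s * vol r + 1)%R; first by rewrite ltr_wpDl// mulr_ge0 ?fine_ge0// ltW.
move=> k; rewrite EFinD EFinM fineK ?ge0_fin_numE//.
apply: (@le_trans _ _ (s * (vol r)%:E)); last by rewrite leeDl.
apply: (@le_trans _ _ (cube_count a J r k)).
  rewrite /cube_count !counting_esum setIC; apply: esum_subset => // j [/= -> Jj].
  by split=> //; rewrite /cube/= supdistkk (le_trans _ Nr)// ler0n.
have := ratio_le k; rewrite /index_ratio div_counting_cube//.
by rewrite lee_pdivrMr.
Qed.

Variables (m : I -> G -> \bar R) (rho : G -> R).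
Hypothesis m_ge0 : forall i n, 0 <= m i n.
Hypothesis m_sum : forall i, \esum_(n in [set: G]) m i n = 1.
Hypothesis m_le : forall i n, m i n <= (rho (a i - n)%R)%:E.
Hypothesis rho_ge0 : forall x, (0 <= rho x)%R.
Hypothesis rho_sum : \esum_(x in [set: G]) (rho x)%:E < +oo.

(** Every [j] in the fibre over [k] puts mass at least 1/2 on one cube around
    [k], whose total mass is at most [K] times its volume. *)
Lemma fibre_bound_of_columns (K : R) : (0 <= K)%R ->
  (forall n, \esum_(j in J) m j n <= K%:E) ->
  exists2 C : R, (0 < C)%R & forall k, counting (J `&` a @^-1` [set k]) <= C%:E.
Proof.
move=> K0 mK.
have rho0 (x : G) : 0 <= (rho x)%:E by rewrite lee_fin.
have h0 : (0 < 2^-1 :> R)%R by rewrite invr_gt0.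
have [S hS] := esum_tail (@free_norm d1 d2 N) rho0 rho_sum h0.
set r := Num.max S%:R%R bound.
have Nr : (bound <= r)%R by rewrite le_max lexx orbT.
have Sr : (S%:R <= r)%R by rewrite le_max lexx.
have V0 : (0 < vol r)%R by exact: cube_volume_gt0.
exists (2 * (K * vol r) + 1)%R.
  by rewrite ltr_wpDl// mulr_ge0// mulr_ge0// ltW.
move=> k; apply: (@le_trans _ _ (2 * (K * vol r))%:E); last first.
  by rewrite lee_fin lerDl.
rewrite EFinM -lee_pdivrMl// -esum_const ?invr_ge0//.
apply: (@le_trans _ _ (\esum_(j in J) \esum_(n in cube r k) m j n)).
  apply: (@le_trans _ _ (\esum_(j in J `&` a @^-1` [set k])
    \esum_(n in cube r k) m j n)); last first.
    by apply: esum_subset => [j []//|j]; exact: esum_ge0.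
  apply: le_esum => j [_ /= <-].
  have -> : (2^-1 = 1 - 2^-1 :> R)%R by lra.
  apply: le_trans (mass_near m_ge0 m_sum m_le j hS) _.
  apply: esum_subset => // n /= nS; rewrite cubeE//=.
  by apply: le_trans Sr; rewrite ler_nat -opprB free_normN.
rewrite esum_exchange// EFinM -(counting_cube k Nr) -esum_const//.
exact: le_esum.
Qed.

End FibreBounds.
End Ratios.

(** * Frame coefficients as localized masses *)

Section InnerProduct.
Variables (R : realType).

Lemma scalar_re_ge0 (s : scalar_kind) (z : scalars R s) :
  0 <= z -> 0 <= scalar_re z.
Proof. by case: s z => //= z; rewrite lecE => /andP[]. Qed.

(** A nonnegative complex number has zero imaginary part. *)
Lemma scalar_reX2 (s : scalar_kind) (z : scalars R s) :
  0 <= z -> scalar_re (z ^+ 2) = scalar_re z ^+ 2.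
Proof.
case: s z => //= -[x y]; rewrite lecE/= => /andP[/eqP -> _].
by rewrite !expr2/= mul0r subr0.
Qed.

Lemma magnitude_ge0 (s : scalar_kind) (z : scalars R s) : 0 <= magnitude z.
Proof. by rewrite scalar_re_ge0. Qed.

Lemma magnitude_conj (s : scalar_kind) (z : scalars R s) :
  magnitude (scalar_conj z) = magnitude z.
Proof. by case: s z => // z; congr (scalar_re _); exact: normcJ. Qed.

Variables (s : scalar_kind) (H : completeNormedModType (scalars R s)).
Variables (ip : {dot H for scalar_conj}).

Lemma hnorm_ge0 (x : H) : 0 <= hnorm x.
Proof. by rewrite scalar_re_ge0. Qed.

Lemma magnitude_ipC (x y : H) : magnitude (ip x y) = magnitude (ip y x).
Proof.
have := @hermitian_subproof _ _ false scalar_conj ip x y.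
by rewrite expr0 mul1r => ->; rewrite magnitude_conj.
Qed.

Lemma magnitude_ip_self (x : H) : hilbert_for ip ->
  magnitude (ip x x) = hnorm x ^+ 2.
Proof.
by move=> hH; rewrite /magnitude hH ger0_norm ?exprn_ge0// scalar_reX2.
Qed.

End InnerProduct.

Section FrameCoefficients.
Variables (R : realType) (s : scalar_kind).
Variables (H : completeNormedModType (scalars R s)).
Variables (ip : {dot H for scalar_conj}).
Hypothesis hH : hilbert_for ip.
Variables (d1 d2 : nat) (N : 'I_d2 -> nat).
Local Notation G := (index_group d1 N).
Variables (g : G -> H).
Local Open Scope ereal_scope.

Lemma coef_mass_ge0 A x : 0 <= coef_mass ip g A x.
Proof. by apply: esum_ge0 => n _; rewrite lee_fin sqr_ge0. Qed.

(** Testing the upper frame bound on [g n] and keeping only the [n]-th term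
    gives |g_n|^4 <= B |g_n|^2. *)
Lemma frame_vector_bound : frame ip g ->
  exists2 B : R, (0 <= B)%R & forall n, (hnorm (g n) ^+ 2 <= B)%R.
Proof.
move=> [A [B [A0 AB hAB]]]; have B0 : (0 < B)%R by exact: lt_le_trans AB.
exists B; first exact: ltW.
move=> n; have /andP[_] := hAB (g n).
set h := (hnorm (g n) ^+ 2)%R => hB.
have : (h ^+ 2)%:E <= (B * h)%:E.
  apply: le_trans hB; rewrite /coef_mass.
  rewrite (esumID [set n])//; last by move=> *; rewrite lee_fin sqr_ge0.
  rewrite setTI esum_set1 ?lee_fin ?sqr_ge0//.
  rewrite magnitude_ip_self// leeDl// esum_ge0// => *.
  by rewrite lee_fin sqr_ge0.
rewrite lee_fin expr2; have : (0 <= h)%R by exact: sqr_ge0.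
by rewrite le_eqVlt => /predU1P[<- _|h0]; [exact: ltW|rewrite ler_pM2r].
Qed.

Variables (I : countType) (f : I -> H).

Definition mass (i : I) (n : G) : \bar R :=
  (coef_mass ip g [set: G] (f i))^-1 * (magnitude (ip (f i) (g n)) ^+ 2)%:E.

Lemma mass_ge0 i n : 0 <= mass i n.
Proof. by rewrite mule_ge0 ?inve_ge0 ?coef_mass_ge0// lee_fin sqr_ge0. Qed.

Variables (u : R).
Hypotheses (hg : frame ip g) (u0 : (0 < u)%R) (hf : forall i, (u <= hnorm (f i))%R).

Lemma coef_mass_bounds : exists2 c : R, (0 < c)%R &
  forall i, exists2 w : R, (c <= w)%R & coef_mass ip g [set: G] (f i) = w%:E.
Proof.
have [A [B [A0 AB hAB]]] := hg; exists (A * u ^+ 2)%R.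
  by rewrite mulr_gt0// exprn_gt0.
move=> i; have /andP[Aw wB] := hAB (f i).
have wfin : coef_mass ip g [set: G] (f i) \is a fin_num.
  by rewrite ge0_fin_numE ?coef_mass_ge0// (le_lt_trans wB)// ltry.
exists (fine (coef_mass ip g [set: G] (f i))); last by rewrite fineK.
rewrite -lee_fin fineK//; apply: le_trans Aw; rewrite lee_fin.
by rewrite ler_wpM2l ?(ltW A0)// lerXn2r// nnegrE ?hnorm_ge0// ltW.
Qed.

Lemma esum_mass i A :
  \esum_(n in A) mass i n =
  (coef_mass ip g [set: G] (f i))^-1 * coef_mass ip g A (f i).
Proof.
have [c c0 /(_ i)[w cw wE]] := coef_mass_bounds.
have w0 : (0 < w)%R by exact: lt_le_trans cw.
rewrite /mass wE inver gt_eqF// esum_scale ?invr_gt0// => n.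
by rewrite lee_fin sqr_ge0.
Qed.

Lemma mass_sum i : \esum_(n in [set: G]) mass i n = 1.
Proof.
have [c c0 /(_ i)[w cw wE]] := coef_mass_bounds.
have w0 : (0 < w)%R by exact: lt_le_trans cw.
by rewrite esum_mass wE inver gt_eqF// -EFinM mulVf ?gt_eqF.
Qed.

Lemma mass_le : exists2 c : R, (0 < c)%R &
  forall i n, mass i n <= (c * magnitude (ip (f i) (g n)) ^+ 2)%:E.
Proof.
have [c c0 hc] := coef_mass_bounds; exists (c^-1)%R; first by rewrite invr_gt0.
move=> i n; have [w cw wE] := hc i.
have w0 : (0 < w)%R by exact: lt_le_trans cw.
rewrite /mass wE inver gt_eqF// -EFinM lee_fin ler_wpM2r ?sqr_ge0//.
by rewrite lef_pV2.
Qed.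

Lemma mass_localized (a : I -> G) : l2_localized ip f a g ->
  exists2 rho : G -> R, (forall x, 0 <= rho x)%R /\
    \esum_(x in [set: G]) (rho x)%:E < +oo &
    forall i n, mass i n <= (rho (a i - n)%R)%:E.
Proof.
move=> [r [roo hr]]; have [c c0 hc] := mass_le.
exists (fun x => c * `|r x| ^+ 2)%R.
  split=> [x|]; first by rewrite mulr_ge0 ?sqr_ge0// ltW.
  under eq_esum do rewrite EFinM.
  rewrite esum_scale//.
  by rewrite lte_mul_pinfty// lee_fin ltW.
move=> i n; apply: le_trans (hc i n) _; rewrite lee_fin.
rewrite ler_wpM2l ?(ltW c0)// lerXn2r ?nnegrE ?magnitude_ge0//.
by rewrite (le_trans (hr i n)) ?ler_norm.
Qed.

(** The Bessel bound is applied to [g n], so that conjugate symmetry of the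
    inner product is used to exchange the two arguments. *)
Lemma mass_columns (J : set I) : bessel ip f ->
  exists2 K : R, (0 <= K)%R & forall n, \esum_(j in J) mass j n <= K%:E.
Proof.
move=> [B hB]; have [C C0 hC] := frame_vector_bound hg.
have [c c0 hc] := mass_le; exists (c * (`|B| * C))%R.
  by rewrite !mulr_ge0// ltW.
move=> n; apply: (@le_trans _ _ (\esum_(i in [set: I]) mass i n)).
  by apply: esum_subset => // i; exact: mass_ge0.
apply: (@le_trans _ _ (c%:E *
    \esum_(i in [set: I]) (magnitude (ip (g n) (f i)) ^+ 2)%:E)).
  rewrite -esum_scale// => [|i]; last by rewrite lee_fin sqr_ge0.
  by apply: le_esum => i _; rewrite magnitude_ipC -EFinM.
rewrite EFinM lee_pmul2l//; apply: le_trans (hB (g n)) _.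
rewrite lee_fin (le_trans (_ : _ <= `|B| * hnorm (g n) ^+ 2)%R)//.
  by rewrite ler_wpM2r ?sqr_ge0 ?ler_norm.
by rewrite ler_wpM2l.
Qed.

Lemma frame_ratioE (J : set I) r k :
  frame_ratio ip f J g r k =
  cube_mass J mass r k / counting (cube r (0%R : G)).
Proof.
by rewrite /frame_ratio; congr (_ / _); apply: eq_esum => j _; rewrite esum_mass.
Qed.

End FrameCoefficients.

Theorem proposition3p7
    (R : realType) (s : scalar_kind)
    (H : completeNormedModType (scalars R s)) (ip : {dot H for scalar_conj})
    (hH : hilbert_for ip)
    (d1 d2 : nat) (N : 'I_d2 -> nat) (hN : forall j : 'I_d2, (0 < N j)%N)
    (I : countType) (g : index_group d1 N -> H) (f : I -> H)
    (a : I -> index_group d1 N)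
    (hg : frame ip g)
    (u : R) (hu : 0 < u) (hf : forall i : I, u <= hnorm (f i))
    (hloc : l2_localized ip f a g)
    (J : set I) :
  [/\ (lower_index_density R a J <= lower_frame_density ip f J g)%E,
      upper_index_density R a J = upper_frame_density ip f J g
    & bessel ip f -> lower_index_density R a J = lower_frame_density ip f J g].
Proof.
have [rho [rho0 rho_sum] m_le] := mass_localized hg hu hf hloc.
have m0 := mass_ge0 ip g f; have m1 := mass_sum hg hu hf.
have fE : frame_ratio ip f J g = fun r k =>
    (cube_mass J (mass ip g f) r k / counting (cube r (0 : index_group d1 N)))%E.
  by apply/funext => r; apply/funext => k; exact: (frame_ratioE hg hu hf).
have [lo up] : (lower_index_density R a J <= lower_frame_density ip f J g)%E /\
    (upper_index_density R a J <= upper_frame_density ip f J g)%E.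
  rewrite /lower_frame_density /upper_frame_density fE.
  apply: (cube_density_le (X := cube_count a J)) => [r k|e e0].
    exact: cube_mass_ge0.
  have [S hS] := cube_count_le_mass J m0 m1 m_le rho0 rho_sum e0.
  exists S => r k Nr; apply: le_trans (hS r k Nr) _; rewrite leeDl//.
  by rewrite -EFinM lee_fin mulr_ge0 ?(ltW e0) ?(ltW (cube_volume_gt0 _ _ r)).
have conv (C : R) : 0 < C ->
    (forall k, counting (J `&` a @^-1` [set k]) <= C%:E)%E ->
    (lower_frame_density ip f J g <= lower_index_density R a J)%E /\
    (upper_frame_density ip f J g <= upper_index_density R a J)%E.
  move=> C0 JC; rewrite /lower_frame_density /upper_frame_density fE.
  apply: (cube_density_le (Y := cube_count a J)) => [r k|e e0].
    exact: counting_ge0.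
  have [S hS] := cube_mass_le_count m0 m1 m_le rho0 rho_sum C0 e0 JC.
  exists S => r k Nr; apply: le_trans (hS r k Nr) _; rewrite leeD2r//.
  by rewrite lee_pemull ?counting_ge0// lee_fin lerDl ltW.
split; first exact: lo.
- apply: le_anti; apply/andP; split; first exact: up.
  have [/fibre_bound_of_density[C C0 /(conv _ C0)[]//]|] :=
    ltP (upper_index_density R a J) +oo%E.
  by rewrite leye_eq => /eqP ->; rewrite leey.
- move=> bf; have [K K0 hK] := mass_columns hH hg hu hf J bf.
  have [C C0 /(conv _ C0)[lo' _]] :=
    fibre_bound_of_columns m0 m1 m_le rho0 rho_sum K0 hK.
  by apply: le_anti; apply/andP; split; [exact: lo|exact: lo'].
Qed.
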